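(* Statement (A) below implies statement (B) below. (A) There exists a universal constant $\lambda>0$ such that for every $n$ and every Boolean function $f\colon\{-1,1\}^n\to\{-1,1\}$, $\ \mathbb{H}(\hat f^2)\le\lambda\cdot\mathsf{C}^1(f)$. (B) (Mansour's conjecture) For every constant $\varepsilon>0$ there is a constant $K_\varepsilon>0$ such that for all $n,t\ge1$ and every Boolean function $f\colon\{-1,1\}^n\to\{-1,1\}$ representable by a $t$-term DNF, there exists a real multilinear polynomial $p$ on $\{-1,1\}^n$ of sparsity at most $K_\varepsilon\, t^{K_\varepsilon}$ with $\mathbb{E}_x[(f(x)-p(x))^2]\le\varepsilon$ ($x$ uniform in $\{-1,1\}^n$).
   Context: All logarithms are base 2. For $g\colon\{-1,1\}^n\to\mathbb{R}$ and $S\subseteq[n]$, $\hat g(S)=\mathbb{E}_x[g(x)\prod_{i\in S}x_i]$. The Fourier entropy of Boolean $f$ is $\mathbb{H}(\hat f^2)=\sum_{S}\hat f(S)^2\log\frac{1}{\hat f(S)^2}$ (with $0\log\frac10=0$). The sparsity of $p$ is $|\{S:\hat p(S)\ne0\}|$. Convention: the value $-1$ stands for ''true'' and $1$ for ''false''. The certificate complexity $\mathsf{C}(f,x)$ of $f$ at $x$ is the minimum number of coordinates of $x$ that need to be fixed to ensure that $f$ is constant (equal to $f(x)$). The $1$-certificate complexity is $\mathsf{C}^1(f)=\max_{x:f(x)=-1}\mathsf{C}(f,x)$ (taken to be $0$ if $f$ is identically $1$). A $t$-term DNF is a disjunction of at most $t$ terms, each a conjunction of variables and negated variables. *)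

(* Defs.v *)
From HB Require Import structures.
From mathcomp Require Import all_boot all_order all_algebra.
From mathcomp Require Import reals exp.

Set Implicit Arguments.
Unset Strict Implicit.
Unset Printing Implicit Defensive.

Import Order.TTheory GRing.Theory Num.Theory.
Local Open Scope ring_scope.

(* The two-point set {-1, 1} is encoded by bool through b |-> (-1) ^+ b, so
   that true stands for -1 and false for 1. *)
Definition cube (n : nat) := {ffun 'I_n -> bool}.

Definition boolfun (n : nat) := cube n -> bool.

Section Fourier.
Variables (R : realType) (n : nat).

Definition sgn (b : bool) : R := (-1) ^+ b.

Definition pm (f : boolfun n) (x : cube n) : R := sgn (f x).

Definition monom (S : {set 'I_n}) (x : cube n) : R := \prod_(i in S) sgn (x i).

Definition expect (g : cube n -> R) : R := (\sum_x g x) / #|{: cube n}|%:R.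

Definition fourier (g : cube n -> R) (S : {set 'I_n}) : R :=
  expect (fun x => g x * monom S x).

Definition log2 (x : R) : R := ln x / ln 2.

(* A summand with fourier g S = 0 vanishes because of its left factor. *)
Definition entropy (g : cube n -> R) : R :=
  \sum_(S : {set 'I_n}) fourier g S ^+ 2 * log2 (1 / fourier g S ^+ 2).

Definition sparsity (g : cube n -> R) : nat :=
  #|[set S : {set 'I_n} | fourier g S != 0]|.

(* The function on the cube given by the multilinear polynomial with
   coefficients c. *)
Definition multilinear (c : {set 'I_n} -> R) (x : cube n) : R :=
  \sum_(S : {set 'I_n}) c S * monom S x.

End Fourier.

Section Complexity.
Variable n : nat.

(* Fixing the coordinates of x in S forces the value f x. *)
Definition certifies (f : boolfun n) (x : cube n) (S : {set 'I_n}) : bool :=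
  [forall y : cube n, [forall i in S, y i == x i] ==> (f y == f x)].

(* The default [set: 'I_n] of arg min always certifies. *)
Definition cert (f : boolfun n) (x : cube n) : nat :=
  #|[arg min_(S < [set: 'I_n] | certifies f x S) #|S| ]|.

Definition cert1 (f : boolfun n) : nat := \max_(x : cube n | f x) cert f x.

(* The literal (i, true) is the variable x_i, and (i, false) its negation. *)
Definition literal := ('I_n * bool)%type.
Definition term := seq literal.
Definition dnf := seq term.

Definition term_eval (T : term) (x : cube n) : bool :=
  all (fun l : literal => x l.1 == l.2) T.

Definition dnf_eval (phi : dnf) (x : cube n) : bool :=
  has (fun T : term => term_eval T x) phi.

Definition dnf_representable (t : nat) (f : boolfun n) : Prop :=
  exists phi : dnf, (size phi <= t)%N /\ forall x, f x = dnf_eval phi x.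

End Complexity.

(* Main.v *)
(* Dropping the terms with more than k = log t + O(1) variables changes f on at
   most a small fraction of the cube and leaves a DNF g with C^1(g) <= k, so g
   has entropy at most lambda k.  The coefficients of g with square below
   2^(- k L) then have total weight at most lambda / L, while by Parseval at
   most 2^(k L) = O(1) t^L coefficients remain: these define p. *)
Require Import Defs.
From HB Require Import structures.
From mathcomp Require Import all_boot all_order all_algebra.
From mathcomp Require Import reals exp.
From mathcomp Require Import lra.

Set Implicit Arguments.
Unset Strict Implicit.
Unset Printing Implicit Defensive.

Import Order.TTheory GRing.Theory Num.Theory.
Local Open Scope ring_scope.

(** * Fourier analysis on the cube; weight of large and small coefficients *)

Section FourierAnalysis.
Variables (R : realType) (n : nat).
Implicit Types (g h : cube n -> R) (f : boolfun n) (S T V : {set 'I_n}).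
Implicit Types (x y : cube n) (c : {set 'I_n} -> R).

Lemma card_cube : #|{: cube n}| = (2 ^ n)%N.
Proof. by rewrite card_ffun card_bool card_ord. Qed.

Lemma card_cube_neq0 : #|{: cube n}|%:R != 0 :> R.
Proof. by rewrite card_cube pnatr_eq0 expn_eq0. Qed.

Lemma eq_expect g h : g =1 h -> expect g = expect h.
Proof. by move=> gh; congr (_ / _); apply: eq_bigr => x _. Qed.

Lemma expectD g h : expect (fun x => g x + h x) = expect g + expect h.
Proof. by rewrite /expect big_split mulrDl. Qed.

Lemma expectZ a g : expect (fun x => a * g x) = a * expect g.
Proof. by rewrite /expect -mulr_sumr mulrA. Qed.

Lemma expect_sum (I : Type) (r : seq I) (P : pred I) (F : I -> cube n -> R) :
  expect (fun x => \sum_(i <- r | P i) F i x) =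
  \sum_(i <- r | P i) expect (F i).
Proof. by rewrite /expect exchange_big mulr_suml. Qed.

Lemma ler_expect g h : (forall x, g x <= h x) -> expect g <= expect h.
Proof.
by move=> gh; rewrite ler_wpM2r ?invr_ge0 ?ler0n //; apply: ler_sum => x _.
Qed.

Lemma expect1 : expect (fun _ : cube n => 1) = 1 :> R.
Proof. by rewrite /expect sumr_const divff // card_cube_neq0. Qed.

Lemma sgnK b : sgn R b * sgn R b = 1.
Proof. by rewrite /sgn -expr2 sqrr_sign. Qed.

Lemma monomE S x : monom R S x = \prod_i (if i \in S then sgn R (x i) else 1).
Proof. by rewrite /monom big_mkcond. Qed.

(** The expectation factors over the coordinates, and a coordinate lying in exactly one of [S] and
    [T] contributes the factor 1 + (-1) = 0. *)
Lemma expect_monomM S T :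
  expect (fun x => monom R S x * monom R T x) = (S == T)%:R.
Proof.
pose F i b : R := (if i \in S then sgn R b else 1) *
                  (if i \in T then sgn R b else 1).
have -> : expect (fun x => monom R S x * monom R T x) =
    (\prod_(i < n) \sum_b F i b) / #|{: cube n}|%:R.
  rewrite bigA_distr_bigA; congr (_ / _); apply: eq_bigr => x _.
  by rewrite !monomE -big_split.
case: eqVneq => [eqST | neST].
  rewrite (eq_bigr (fun=> 2%:R)) => [|i _].
    by rewrite prodr_const card_ord card_cube natrX divff // expf_neq0 ?pnatr_eq0.
  by rewrite big_bool /F eqST; case: ifP; rewrite ?sgnK ?mulr1.
have [i neq_i] : exists i, (i \in S) != (i \in T).
  apply/existsP; rewrite -negb_forall; apply: contra neST => /forallP eqST.
  by apply/eqP/setP => i; apply/eqP.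
rewrite (bigD1 i) //= big_bool /F /sgn.
by case: (i \in S) (i \in T) neq_i => [] [] //= _;
  rewrite ?mul1r ?mulr1 ?addNr !mul0r.
Qed.

Lemma fourier_multilinear c S : fourier (multilinear c) S = c S.
Proof.
rewrite /fourier (@eq_expect _
  (fun x => \sum_T c T * (monom R T x * monom R S x))) => [|x].
  rewrite expect_sum (bigD1 S) //= expectZ expect_monomM eqxx mulr1.
  rewrite big1 ?addr0 // => T neTS.
  by rewrite expectZ expect_monomM (negPf neTS) mulr0.
by rewrite /multilinear mulr_suml; apply: eq_bigr => T _; rewrite mulrA.
Qed.

Lemma parseval c :
  expect (fun x => multilinear c x ^+ 2) = \sum_S c S ^+ 2.
Proof.
rewrite (@eq_expect _
  (fun x => \sum_S c S * (multilinear c x * monom R S x))) => [|x].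
  rewrite expect_sum; apply: eq_bigr => S _.
  by rewrite expectZ -/(fourier _ S) fourier_multilinear.
rewrite expr2 {1}/multilinear mulr_suml; apply: eq_bigr => S _.
by rewrite -mulrA (mulrC (monom _ _ _)).
Qed.

(** Dual orthogonality: the sum over [S] is the expansion of the product of the factors
    [x i * y i + 1] (as signs), which vanishes at a coordinate where [x] and [y] differ and is 2
    elsewhere. *)
Lemma sum_monomM x y :
  \sum_S monom R S x * monom R S y = #|{: cube n}|%:R * (x == y)%:R.
Proof.
have -> : \sum_S monom R S x * monom R S y =
    \prod_i (sgn R (x i) * sgn R (y i) + 1).
  rewrite bigA_distr; apply: eq_bigr => S _.
  rewrite !monomE -big_split; apply: eq_bigr => i _ /=.
  by case: ifP; rewrite ?mulr1.
case: eqVneq => [eq_xy | neq_xy].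
  rewrite (eq_bigr (fun=> 2%:R)) => [|i _]; last by rewrite eq_xy sgnK.
  by rewrite prodr_const card_ord card_cube natrX mulr1.
have [i neq_i] : exists i, x i != y i.
  apply/existsP; rewrite -negb_forall; apply: contra neq_xy => /forallP eqxy.
  by apply/eqP/ffunP => i; apply/eqP.
rewrite mulr0 (bigD1 i) //= /sgn.
by case: (x i) (y i) neq_i => [] [] //= _; rewrite ?mul1r ?mulr1 addNr mul0r.
Qed.

(** Fourier inversion: once the sums are exchanged, [sum_monomM] turns the kernel into a point mass
    at [x]. *)
Lemma multilinear_fourier g : multilinear (fourier g) =1 g.
Proof.
move=> x; rewrite /multilinear /fourier /expect.
under eq_bigr => S _ do rewrite mulrAC mulr_suml.
rewrite -mulr_suml exchange_big /=.
rewrite (eq_bigr (fun y => g y * (#|{: cube n}|%:R * (y == x)%:R))) => [|y _].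
  rewrite (bigD1 x) //= big1 => [|y neq_yx].
    by rewrite eqxx mulr1 addr0 mulfK // card_cube_neq0.
  by rewrite (negPf neq_yx) !mulr0.
by rewrite -sum_monomM mulr_sumr; apply: eq_bigr => S _; rewrite mulrA.
Qed.

Lemma sum_fourier_sq g : \sum_S fourier g S ^+ 2 = expect (fun x => g x ^+ 2).
Proof.
by rewrite -parseval; apply: eq_expect => x; rewrite multilinear_fourier.
Qed.

Lemma sum_fourier_pm f : \sum_S fourier (pm R f) S ^+ 2 = 1.
Proof.
rewrite sum_fourier_sq (@eq_expect _ (fun=> 1)) ?expect1 // => x.
by rewrite /pm /sgn sqrr_sign.
Qed.

(** The threshold is a power of two, so that [b] bounds both the number of heavy sets, by [2 ^ b],
    and the logarithms of the light ones, from below. *)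
Definition heavy (b : nat) g : pred {set 'I_n} :=
  fun S => 2%:R ^- b <= fourier g S ^+ 2.

(** Each heavy set takes at least [2 ^- b] of a total weight 1. *)
Lemma card_heavy b f : (#|heavy b (pm R f)| <= 2 ^ b)%N.
Proof.
have p2b : 0 < 2%:R ^+ b :> R by rewrite exprn_gt0.
rewrite -(ler_nat R) natrX -[leRHS]mul1r -ler_pdivrMr // -[leRHS](sum_fourier_pm f).
rewrite [leRHS](bigID (heavy b (pm R f))) /= mulr_natl -sumr_const.
rewrite ler_wpDr ?sumr_ge0 // => [S _|]; first exact: sqr_ge0.
exact: ler_sum.
Qed.

Lemma fourier_pm_sq_le1 f S : fourier (pm R f) S ^+ 2 <= 1.
Proof.
rewrite -[leRHS](sum_fourier_pm f) (bigD1 S) //= lerDl sumr_ge0 // => T _.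
exact: sqr_ge0.
Qed.

(** A Markov-type bound: the logarithm in a light summand is at least [b], and heavy summands are
    nonnegative since no squared coefficient exceeds 1. *)
Lemma light_weight_entropy b f :
  b%:R * (\sum_(S | ~~ heavy b (pm R f) S) fourier (pm R f) S ^+ 2)
    <= entropy (pm R f).
Proof.
have ln2 : 0 < ln 2 :> R by rewrite ln_gt0 ?ltr1n.
have log2_ge (v : R) (d : nat) : 0 < v -> v <= 2%:R ^- d -> d%:R <= log2 (1 / v).
  move=> v0 vd; rewrite /log2 ler_pdivlMr // mulr_natl -lnXn //.
  rewrite ler_ln ?posrE ?exprn_gt0 ?divr_gt0 //.
  by rewrite div1r -[leLHS]invrK lef_pV2 ?posrE ?invr_gt0 ?exprn_gt0.
have term_ge S (d : nat) : fourier (pm R f) S ^+ 2 <= 2%:R ^- d ->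
    d%:R * fourier (pm R f) S ^+ 2 <=
    fourier (pm R f) S ^+ 2 * log2 (1 / fourier (pm R f) S ^+ 2).
  move=> le_d; have := sqr_ge0 (fourier (pm R f) S).
  rewrite le_eqVlt => /predU1P [<- | v0]; first by rewrite mulr0 mul0r.
  by rewrite mulrC ler_pM2l // log2_ge.
rewrite /entropy [leRHS](bigID (heavy b (pm R f))) /= mulr_sumr.
rewrite ler_wpDl ?sumr_ge0 // => [S _|].
  (* Nonnegativity of a heavy summand is the case [d = 0], where the threshold is 1. *)
  by rewrite (le_trans _ (term_ge S 0%N _)) ?mul0r // expr0 invr1 fourier_pm_sq_le1.
by apply: ler_sum => S; rewrite -ltNge => /ltW /term_ge.
Qed.

(** The error is the polynomial made of the light coefficients, so Parseval applies. *)
Lemma expect_sub_heavy b g :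
  expect (fun x => (g x -
    multilinear (fun S => if heavy b g S then fourier g S else 0) x) ^+ 2) =
  \sum_(S | ~~ heavy b g S) fourier g S ^+ 2.
Proof.
rewrite (@eq_expect _
  (fun x => multilinear (fun S => if heavy b g S then 0 else fourier g S) x ^+ 2)).
  by rewrite parseval [RHS]big_mkcond; apply: eq_bigr => S _;
    case: (heavy b g S); rewrite //= expr0n.
move=> x; rewrite -[in LHS]multilinear_fourier /multilinear -sumrB.
congr (_ ^+ 2); apply: eq_bigr => S _.
by case: ifP => _; rewrite ?subrr mul0r // subr0.
Qed.

End FourierAnalysis.

(** * Width of DNF terms, certificates, and removal of wide terms *)

Section Dnf.
Variable n : nat.
Implicit Types (T : term n) (phi : dnf n) (x y : cube n) (f : boolfun n).

(** A set, so that repeated literals do not inflate the width. *)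
Definition term_vars T : {set 'I_n} := [set i | i \in map fst T].

Lemma term_eval_agree T x y :
  term_eval T x -> {in term_vars T, x =1 y} -> term_eval T y.
Proof.
move=> /allP Tx xy; apply/allP => l lT; rewrite -(eqP (Tx l lT)) eq_sym.
by apply/eqP/xy; rewrite inE map_f.
Qed.

Lemma term_eval_inj T x y :
  term_eval T x -> term_eval T y -> {in term_vars T, x =1 y}.
Proof.
move=> /allP Tx /allP Ty i; rewrite inE => /mapP [l lT ->].
by rewrite (eqP (Tx l lT)) (eqP (Ty l lT)).
Qed.

Lemma card_agree (V : {set 'I_n}) (x : cube n) :
  (#|[pred y : cube n | [forall i in V, y i == x i]]| * 2 ^ #|V| = 2 ^ n)%N.
Proof.
(* The indicator of agreement is a product over coordinates, so the count is a product too: 1 choice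
   on [V], 2 off [V]. *)
have -> : #|[pred y : cube n | [forall i in V, y i == x i]]| =
    (\prod_(i < n) \sum_(b : bool) ((i \in V) ==> (b == x i)))%N.
  rewrite bigA_distr_bigA -sum1_card big_mkcond; apply: eq_bigr => y _ /=.
  rewrite inE; case: (boolP [forall _ in _, _]) => [/forall_inP yx | ].
    by rewrite big1 // => i _; case: (boolP (i \in V)) => // /yx ->.
  case/forall_inPn => i iV yxi.
  by rewrite (bigD1 i) //= iV (negPf yxi).
have -> : (2 ^ #|V| = \prod_(i < n) (if i \in V then 2 else 1))%N.
  by rewrite -big_mkcond prod_nat_const.
rewrite -big_split -[X in (2 ^ X)%N]card_ord -prod_nat_const.
by apply: eq_bigr => i _; rewrite big_bool /=; case: ifP => // _; case: (x i).
Qed.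

(** Points satisfying [T] all agree on its variables; a contradictory term has none, whence an
    inequality. *)
Lemma card_term_eval T : (#|term_eval T| * 2 ^ #|term_vars T| <= 2 ^ n)%N.
Proof.
have [->//|/pred0Pn [x Tx]] := eqVneq #|term_eval T| 0%N.
rewrite -(card_agree (term_vars T) x) leq_mul2r subset_leq_card ?orbT //.
apply/subsetP => y Ty; rewrite inE; apply/forall_inP => i iT.
by apply/eqP/(term_eval_inj Ty Tx).
Qed.

(** At a true point some term holds, and fixing its variables keeps the disjunction true. *)
Lemma cert1_le_width phi k :
  (forall T, T \in phi -> #|term_vars T| <= k)%N ->
  (cert1 (dnf_eval phi) <= k)%N.
Proof.
move=> width; apply/bigmax_leqP => x /hasP [T Tphi Tx].
rewrite /cert; case: arg_minnP => [|S _ minS].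
  apply/forallP => y; apply/implyP => /forall_inP yx; apply/eqP.
  by congr (dnf_eval phi _); apply/ffunP => i; apply/eqP/yx.
apply: leq_trans (width T Tphi); apply: minS.
apply/forallP => y; apply/implyP => /forall_inP yx.
have -> : dnf_eval phi x by apply/hasP; exists T.
apply/eqP/hasP; exists T => //; apply: term_eval_agree Tx _ => i iT.
by apply/esym/eqP/yx.
Qed.

Definition narrow k phi : dnf n := [seq T <- phi | #|term_vars T| <= k]%N.

Lemma cert1_narrow k phi : (cert1 (dnf_eval (narrow k phi)) <= k)%N.
Proof. by apply: cert1_le_width => T; rewrite mem_filter => /andP []. Qed.

(** Union bound: the two functions differ only where some wide term holds, the squared difference
    there is 4, and each wide term holds with probability at most [2 ^- k]. *)
Lemma expect_sub_narrow (R : realType) k phi f : f =1 dnf_eval phi ->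
  expect (fun x => (pm R f x - pm R (dnf_eval (narrow k phi)) x) ^+ 2)
    <= 4 * (size phi)%:R / 2 ^+ k.
Proof.
move=> fphi; pose wide T := (k < #|term_vars T|)%N.
apply: (@le_trans _ _ (expect (fun x =>
    \sum_(T <- phi | wide T) 4 * (term_eval T x)%:R))).
  apply: ler_expect => x; rewrite /pm fphi.
  have sum_ge0 : 0 <= \sum_(T <- phi | wide T) 4 * (term_eval T x)%:R :> R.
    by apply: sumr_ge0 => T _; rewrite mulr_ge0.
  have [-> | neq] := eqVneq (dnf_eval phi x) (dnf_eval (narrow k phi) x).
    by rewrite subrr expr0n /=.
  (* Removing terms can only turn true into false, so [phi] holds at [x], and a term witnessing this
     was removed. *)
  have [T [Tphi wT Tx]] : exists T, [/\ T \in phi, wide T & term_eval T x].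
    have /hasP [T Tphi Tx] : dnf_eval phi x.
      apply: contraTT neq => phix; rewrite negbK (negPf phix) eq_sym.
      apply/eqP/negbTE; apply: contra phix => /hasP [T].
      by rewrite mem_filter => /andP [_ Tphi] Tx; apply/hasP; exists T.
    exists T; split=> //; apply: contraR neq; rewrite -leqNgt => narrowT.
    have -> : dnf_eval phi x by apply/hasP; exists T.
    by rewrite eq_sym; apply/eqP/hasP; exists T; rewrite ?mem_filter ?narrowT.
  rewrite (big_rem T) //= wT Tx mulr1 ler_wpDr //.
    by apply: sumr_ge0 => U _; rewrite mulr_ge0.
  by rewrite /sgn; case: (dnf_eval phi x) neq; case: (dnf_eval _ x) => // _;
    rewrite ?expr0 ?expr1; lra.
rewrite expect_sum -sum1_size natr_sum mulr_sumr mulr_suml.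
rewrite [leRHS](bigID wide) /= ler_wpDr ?sumr_ge0 // => [T _|].
  by rewrite mulr1 divr_ge0 ?exprn_ge0.
apply: ler_sum => T wT; rewrite expectZ mulr1 ler_wpM2l //.
rewrite /expect card_cube -natr_sum.
rewrite ler_pdivrMr ?ltr0n ?expn_gt0 // mulrC ler_pdivlMr ?exprn_gt0 //.
rewrite -natrX -natrM ler_nat; apply: leq_trans (card_term_eval T).
rewrite leq_mul ?leq_exp2l ?(ltnW wT) // -sum1_card [in leqRHS]big_mkcond.
by apply: leq_sum => x _; rewrite -topredE /=; case: (term_eval T x).
Qed.

End Dnf.

(** * Choice of parameters and the approximating polynomial *)

Theorem proposition3p10 (R : realType) :
  (exists lambda : R, 0 < lambda /\
     forall (n : nat) (f : boolfun n),
       entropy (pm R f) <= lambda * (cert1 f)%:R) ->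
  (forall eps : R, 0 < eps ->
     exists K : R, 0 < K /\
       forall (n t : nat), (1 <= n)%N -> (1 <= t)%N ->
       forall f : boolfun n, dnf_representable t f ->
       exists p : {set 'I_n} -> R,
         (sparsity (multilinear p))%:R <= K * (t%:R `^ K) /\
         expect (fun x => (pm R f x - multilinear p x) ^+ 2) <= eps).
Proof.
case=> lambda [lambda0 entropy_le] eps eps0.
(* Since [2 ^ k] will be [2 ^ a * 2 ^ m.+1] with [t < 2 ^ m.+1], the truncation error is at most
   [4 / 2 ^+ a], hence at most [eps / 4]. *)
have [a a_ge] : exists a : nat, 16 / eps <= 2 ^+ a.
  exists (Num.bound (16 / eps)); rewrite ltW //.
  apply: lt_trans (archi_boundP _) _; first by rewrite divr_ge0 // ltW.
  by rewrite -natrX ltr_nat ltn_expl.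
(* Makes the light weight, at most [lambda / L], at most [eps / 4]. *)
have [L [L_gt0 L_ge]] : exists L : nat, (0 < L)%N /\ 4 * lambda / eps <= L%:R.
  exists (Num.bound (4 * lambda / eps)).+1; split=> //.
  rewrite ltW // (lt_trans (archi_boundP _)) ?ltr_nat //.
  by rewrite divr_ge0 ?mulr_ge0 // ltW.
(* The sparsity bound will be [2 ^ (a.+1 * L) * t ^ L]; the sum dominates both its constant and its
   exponent. *)
set K := ((2 ^ (a.+1 * L)) + L)%N.
exists K%:R; split; first by rewrite ltr0n /K addn_gt0 L_gt0 orbT.
move=> n t _ t_gt0 f [phi [size_phi f_phi]].
pose m := trunc_log 2 t; pose k := (a + m.+1)%N; pose b := (k * L)%N.
have /andP [m_le m_gt] : (2 ^ m <= t < 2 ^ m.+1)%N by exact: trunc_log_bounds.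
pose g := dnf_eval (narrow k phi).
pose c S : R := if heavy b (pm R g) S then fourier (pm R g) S else 0.
exists c.
have t1 : 1 <= t%:R :> R by rewrite ler1n.
split.
  have le_card : (sparsity (multilinear c) <= 2 ^ b)%N.
    apply: leq_trans (card_heavy R b g); apply: subset_leq_card.
    apply/subsetP => S; rewrite inE fourier_multilinear unfold_in /c.
    by case: ifP; rewrite ?eqxx.
  (* The [L]-th power of [2 ^ k = 2 ^ a.+1 * 2 ^ m <= 2 ^ a.+1 * t]. *)
  have le_b : (2 ^ b <= 2 ^ (a.+1 * L) * t ^ L)%N.
    by rewrite /b /k -addSnnS mulnDl expnD leq_mul // expnM leq_exp2r.
  apply: (@le_trans _ _ (2 ^ (a.+1 * L) * t ^ L)%N%:R).
    by rewrite ler_nat (leq_trans le_card).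
  rewrite natrM ler_pM ?ler_nat ?leq_addr //.
  by rewrite natrX -powR_mulrn // ler_powR // ler_nat leq_addl.
have k_gt0 : 0 < k%:R :> R by rewrite ltr0n /k addnS.
have light_le : \sum_(S | ~~ heavy b (pm R g) S) fourier (pm R g) S ^+ 2
    <= eps / 4.
  have := light_weight_entropy R b g; set w := \sum_(S | _) _ => w_le.
  (* The entropy lies between [k * L * w] and [lambda * k]; the factor [k], which depends on [t],
     cancels. *)
  have : L%:R * w <= lambda.
    rewrite -(ler_pM2l k_gt0) mulrA -natrM (le_trans w_le) //.
    rewrite (le_trans (entropy_le n g)) // mulrC ler_pM2r // ler_nat.
    exact: cert1_narrow.
  have L0 : 0 < L%:R :> R by rewrite ltr0n.
  rewrite mulrC -ler_pdivlMr // => /le_trans; apply.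
  rewrite ler_pdivrMr //; move: L_ge; rewrite ler_pdivrMr //; lra.
have narrow_le := @expect_sub_narrow n R k phi f f_phi.
have width_le : 4 * (size phi)%:R / 2 ^+ k <= eps / 4.
  rewrite ler_pdivrMr ?exprn_gt0 // /k exprD.
  have st : (size phi)%:R <= 2 ^+ m.+1 :> R.
    by rewrite -natrX ler_nat (leq_trans size_phi) // ltnW.
  have : 16 <= eps * 2 ^+ a by rewrite mulrC -ler_pdivrMr.
  move: st; have : 0 <= 2 ^+ m.+1 :> R by rewrite exprn_ge0.
  set u := 2 ^+ m.+1; set v := 2 ^+ a; set s := (size phi)%:R => u0 su ev.
  have : 16 * u <= eps * v * u by rewrite ler_wpM2r.
  lra.
(* Passing through [g] doubles both squared errors, so two bounds of [eps / 4] add up to [eps]. *)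
apply: (@le_trans _ _ (expect (fun x =>
    2 * (pm R f x - pm R g x) ^+ 2 + 2 * (pm R g x - multilinear c x) ^+ 2))).
  apply: ler_expect => x; move: (pm R f x) (pm R g x) (multilinear c x) => A B C.
  (* This square is exactly the difference of the two sides. *)
  have := sqr_ge0 (A - B - (B - C)); nra.
rewrite expectD !expectZ expect_sub_heavy -/g in narrow_le *; lra.
Qed.
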